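(* Let $N$ be a strictly reflexive object of a compact closed category $(\mathcal C,\otimes,t,s,I)$ with trivial scalars, and suppose $N$ is not a unit object. Then $\mathcal C(N,N)$, with composition and with $\otimes$ (since $N\otimes N=N$), is a one-object semi-monoidal category. Let $\alpha=t_{N,N,N}\in\mathcal C(N,N)$ be the associator, and $\Delta,\nabla\in\mathcal C(N,N)$ the split and merge arrows of the standard Frobenius algebra at $N=N^*\otimes N$. Let $\mathbb A\subseteq\mathcal C(N,N)$ be the closure of $\{\alpha,\alpha^{-1},\Delta,\nabla\}$ under composition and $\otimes$. Then: (1) the closure of $\{\alpha,\alpha^{-1}\}$ under composition and $\otimes$ is a subgroup of $\mathbb A$ isomorphic to Thompson's group $\mathcal F$; (2) the submonoid generated by $\{\Delta,\nabla\}$ under composition is isomorphic to the bicyclic monoid $\mathcal B$.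
   Context: Strictly reflexive: $[N\to N]=N^*\otimes N=N$ with $\mathrm{app},\mathrm{lam}$ identities. Trivial scalars: $\mathcal C(I,I)=\{1_I\}$. Not a unit object: it is not the case that $f\mapsto 1_N\otimes f$ and $f\mapsto f\otimes1_N$ are bijections of $\mathcal C(N,N)$. Standard Frobenius algebra at $X^*\otimes X$: $\Delta=(1_{X^*}\otimes\eta_X\otimes1_X)$ composed with $X^*\otimes X\cong X^*\otimes I\otimes X$, $\nabla=(1_{X^*}\otimes\epsilon_{X^*}\otimes1_X)$ followed by $X^*\otimes I\otimes X\cong X^*\otimes X$ (here $X=N$). Thompson's group $\mathcal F=\langle x_0,x_1,x_2,\dots\mid x_i^{-1}x_jx_i=x_{j+1}\ \forall i<j\rangle$. The bicyclic monoid $\mathcal B=\langle r,s\mid rs=1\rangle$. *)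

(* Defs.v *)
From Stdlib Require Import List Arith.
Import ListNotations.

Record CCData := {
  Obj : Type;
  Hom : Obj -> Obj -> Type;
  idm : forall A, Hom A A;
  cmp : forall A B C, Hom B C -> Hom A B -> Hom A C;
  tens : Obj -> Obj -> Obj;
  tensm : forall A B C D, Hom A B -> Hom C D -> Hom (tens A C) (tens B D);
  tunit : Obj;
  assoc : forall A B C, Hom (tens A (tens B C)) (tens (tens A B) C);
  assoc_inv : forall A B C, Hom (tens (tens A B) C) (tens A (tens B C));
  lunit : forall A, Hom (tens tunit A) A;
  lunit_inv : forall A, Hom A (tens tunit A);
  runit : forall A, Hom (tens A tunit) A;
  runit_inv : forall A, Hom A (tens A tunit);
  sym : forall A B, Hom (tens A B) (tens B A);
  dual : Obj -> Obj;
  eta : forall A, Hom tunit (tens A (dual A));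
  eps : forall A, Hom (tens (dual A) A) tunit }.

Arguments Hom {c} _ _.
Arguments idm {c} _.
Arguments cmp {c A B C} _ _.
Arguments tens {c} _ _.
Arguments tensm {c A B C D} _ _.
Arguments tunit c.
Arguments assoc {c} _ _ _.
Arguments assoc_inv {c} _ _ _.
Arguments lunit {c} _.
Arguments lunit_inv {c} _.
Arguments runit {c} _.
Arguments runit_inv {c} _.
Arguments sym {c} _ _.
Arguments dual {c} _.
Arguments eta {c} _.
Arguments eps {c} _.

Record IsCompactClosed (K : CCData) : Prop := {
  cmp_idl : forall (A B : Obj K) (f : Hom A B), cmp (idm B) f = f;
  cmp_idr : forall (A B : Obj K) (f : Hom A B), cmp f (idm A) = f;
  cmp_assoc : forall (A B C D : Obj K) (f : Hom A B) (g : Hom B C) (h : Hom C D),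
      cmp h (cmp g f) = cmp (cmp h g) f;
  tensm_id : forall (A B : Obj K), tensm (idm A) (idm B) = idm (tens A B);
  tensm_cmp : forall (A1 A2 A3 B1 B2 B3 : Obj K) (f : Hom A1 A2) (g : Hom A2 A3)
      (f' : Hom B1 B2) (g' : Hom B2 B3),
      tensm (cmp g f) (cmp g' f') = cmp (tensm g g') (tensm f f');
  assoc_iso1 : forall (A B C : Obj K), cmp (assoc_inv A B C) (assoc A B C) = idm _;
  assoc_iso2 : forall (A B C : Obj K), cmp (assoc A B C) (assoc_inv A B C) = idm _;
  assoc_nat : forall (A A' B B' C C' : Obj K) (f : Hom A A') (g : Hom B B') (h : Hom C C'),
      cmp (assoc A' B' C') (tensm f (tensm g h)) = cmp (tensm (tensm f g) h) (assoc A B C);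
  lunit_iso1 : forall (A : Obj K), cmp (lunit_inv A) (lunit A) = idm _;
  lunit_iso2 : forall (A : Obj K), cmp (lunit A) (lunit_inv A) = idm _;
  lunit_nat : forall (A B : Obj K) (f : Hom A B),
      cmp (lunit B) (tensm (idm (tunit K)) f) = cmp f (lunit A);
  runit_iso1 : forall (A : Obj K), cmp (runit_inv A) (runit A) = idm _;
  runit_iso2 : forall (A : Obj K), cmp (runit A) (runit_inv A) = idm _;
  runit_nat : forall (A B : Obj K) (f : Hom A B),
      cmp (runit B) (tensm f (idm (tunit K))) = cmp f (runit A);
  pentagon : forall (A B C D : Obj K),
      cmp (assoc (tens A B) C D) (assoc A B (tens C D))
      = cmp (tensm (assoc A B C) (idm D))
            (cmp (assoc A (tens B C) D) (tensm (idm A) (assoc B C D)));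
  triangle : forall (A B : Obj K),
      cmp (tensm (runit A) (idm B)) (assoc A (tunit K) B) = tensm (idm A) (lunit B);
  sym_nat : forall (A A' B B' : Obj K) (f : Hom A A') (g : Hom B B'),
      cmp (sym A' B') (tensm f g) = cmp (tensm g f) (sym A B);
  sym_inv : forall (A B : Obj K), cmp (sym B A) (sym A B) = idm _;
  hexagon : forall (A B C : Obj K),
      cmp (assoc_inv B C A) (cmp (sym A (tens B C)) (assoc_inv A B C))
      = cmp (tensm (idm B) (sym A C)) (cmp (assoc_inv B A C) (tensm (sym A B) (idm C)));
  snake1 : forall (A : Obj K),
      cmp (runit A) (cmp (tensm (idm A) (eps A))
        (cmp (assoc_inv A (dual A) A) (cmp (tensm (eta A) (idm A)) (lunit_inv A))))
      = idm A;
  snake2 : forall (A : Obj K),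
      cmp (lunit (dual A)) (cmp (tensm (eps A) (idm (dual A)))
        (cmp (assoc (dual A) A (dual A)) (cmp (tensm (idm (dual A)) (eta A))
          (runit_inv (dual A)))))
      = idm (dual A) }.

Definition trivial_scalars (K : CCData) : Prop :=
  forall f : Hom (tunit K) (tunit K), f = idm (tunit K).

Definition castH {K : CCData} {A B A' B' : Obj K} (ea : A = A') (eb : B = B')
  (f : Hom A B) : Hom A' B' :=
  match ea in _ = X return Hom X B' with
  | eq_refl => match eb in _ = Y return Hom A Y with eq_refl => f end
  end.

Definition bijectiveT {T : Type} (h : T -> T) : Prop :=
  exists g : T -> T, (forall x, g (h x) = x) /\ (forall y, h (g y) = y).

Section NStuff.
Context {K : CCData} (N : Obj K) (HNN : tens N N = N) (HdN : tens (dual N) N = N).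

Definition stens (f g : Hom N N) : Hom N N := castH HNN HNN (tensm f g).

Definition not_unit_object : Prop :=
  ~ (bijectiveT (fun f => stens (idm N) f) /\ bijectiveT (fun f => stens f (idm N))).

Definition eqN_NN : tens N (tens N N) = N := eq_trans (f_equal (tens N) HNN) HNN.
Definition eqNN_N : tens (tens N N) N = N :=
  eq_trans (f_equal (fun X => tens X N) HNN) HNN.

Definition alphaN : Hom N N := castH eqN_NN eqNN_N (assoc N N N).
Definition alphaN_inv : Hom N N := castH eqNN_N eqN_NN (assoc_inv N N N).

Definition eqDD : tens (tens (dual N) N) (tens (dual N) N) = N :=
  eq_trans (f_equal2 tens HdN HdN) HNN.

Definition Delta0 : Hom (tens (dual N) N) (tens (tens (dual N) N) (tens (dual N) N)) :=
  cmp (assoc_inv (tens (dual N) N) (dual N) N)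
   (cmp (tensm (assoc (dual N) N (dual N)) (idm N))
    (cmp (tensm (tensm (idm (dual N)) (eta N)) (idm N))
         (tensm (runit_inv (dual N)) (idm N)))).

(* counit for X* (with X as its dual): X (x) X* -> I *)
Definition eps_dual : Hom (tens N (dual N)) (tunit K) := cmp (eps N) (sym N (dual N)).

Definition Nabla0 : Hom (tens (tens (dual N) N) (tens (dual N) N)) (tens (dual N) N) :=
  cmp (tensm (runit (dual N)) (idm N))
   (cmp (tensm (tensm (idm (dual N)) eps_dual) (idm N))
    (cmp (tensm (assoc_inv (dual N) N (dual N)) (idm N))
         (assoc (tens (dual N) N) (dual N) N))).

Definition DeltaN : Hom N N := castH HdN eqDD Delta0.
Definition NablaN : Hom N N := castH eqDD HdN Nabla0.

Inductive tclosure (S : Hom N N -> Prop) : Hom N N -> Prop :=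
| tc_base f : S f -> tclosure S f
| tc_cmp f g : tclosure S f -> tclosure S g -> tclosure S (cmp f g)
| tc_tens f g : tclosure S f -> tclosure S g -> tclosure S (stens f g).

Inductive mclosure (S : Hom N N -> Prop) : Hom N N -> Prop :=
| mc_id : mclosure S (idm N)
| mc_base f : S f -> mclosure S f
| mc_cmp f g : mclosure S f -> mclosure S g -> mclosure S (cmp f g).

Definition genAlpha (f : Hom N N) : Prop := f = alphaN \/ f = alphaN_inv.
Definition genAll (f : Hom N N) : Prop :=
  f = alphaN \/ f = alphaN_inv \/ f = DeltaN \/ f = NablaN.
Definition genFrob (f : Hom N N) : Prop := f = DeltaN \/ f = NablaN.

End NStuff.

Inductive pcong {X : Type} (R : list X -> list X -> Prop) : list X -> list X -> Prop :=
| pc_rel u v p q : R u v -> pcong R (p ++ u ++ q) (p ++ v ++ q)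
| pc_refl u : pcong R u u
| pc_sym u v : pcong R u v -> pcong R v u
| pc_trans u v w : pcong R u v -> pcong R v w -> pcong R u w.

(* Thompson's group F = < x_0, x_1, ... | x_i^-1 x_j x_i = x_{j+1} (i<j) >,
   as a monoid presentation on generators and formal inverses *)
Inductive tletter := tgen (n : nat) | tinv (n : nat).

Inductive thompson_rel : list tletter -> list tletter -> Prop :=
| tr_inv1 n : thompson_rel [tgen n; tinv n] []
| tr_inv2 n : thompson_rel [tinv n; tgen n] []
| tr_conj i j : i < j -> thompson_rel [tinv i; tgen j; tgen i] [tgen (S j)].

Inductive bletter := br | bs.

Inductive bicyclic_rel : list bletter -> list bletter -> Prop :=
| br_rs : bicyclic_rel [br; bs] [].

(* phi induces an isomorphism of monoids from  (list X)/pcong R  onto the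
   set S of arrows with composition *)
Definition presents_iso {K : CCData} {N : Obj K} {X : Type}
  (R : list X -> list X -> Prop) (phi : list X -> Hom N N) (S : Hom N N -> Prop) : Prop :=
  phi [] = idm N /\
  (forall u v, phi (u ++ v) = cmp (phi u) (phi v)) /\
  (forall u v, phi u = phi v <-> pcong R u v) /\
  (forall f, S f <-> exists u, phi u = f).

(* Main.v *)
Require Import Defs.
From Stdlib Require Import List Arith Lia Setoid Morphisms.
Import ListNotations.

(* Trivial scalars make every object of dimension 1, so tensoring with [1_N] is
   faithful, and [nabla . Delta = 1].

   Thompson's group acts by [x_0 |-> alpha], [x_n |-> 1 (x) ... (x) 1 (x) alpha]
   ([n] factors [1]): the defining relations are naturality of [alpha], and
   [alpha (x) 1] lies in the image by the pentagon.  Every element of the group is a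
   fraction of positive words in normal form, so a kernel element gives two distinct
   normal forms with equal image.  Stripping common factors leaves
   [alpha^c = 1 (x) g] with [c > 0]; this forces [alpha = 1], and then naturality
   and faithfulness give [1 (x) f = f = f (x) 1], i.e. [N] is a unit object.

   The bicyclic monoid is represented faithfully as soon as [Delta . nabla <> 1];
   otherwise [N] would be isomorphic to [I]. *)

(** * Congruences on words *)

Section PresentationCongruence.
Context {X : Type} (R : list X -> list X -> Prop).

Global Instance pcong_Equivalence : Equivalence (pcong R).
Proof.
split.
- intros u; apply pc_refl.
- intros u v; apply pc_sym.
- intros u v w; apply pc_trans.
Qed.

Lemma pcong_ctx p q u v : pcong R u v -> pcong R (p ++ u ++ q) (p ++ v ++ q).
Proof.
induction 1 as [u v p' q' H | | |].
- replace (p ++ (p' ++ u ++ q') ++ q) with ((p ++ p') ++ u ++ (q' ++ q))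
    by now rewrite !app_assoc.
  replace (p ++ (p' ++ v ++ q') ++ q) with ((p ++ p') ++ v ++ (q' ++ q))
    by now rewrite !app_assoc.
  now apply pc_rel.
- reflexivity.
- now symmetry.
- etransitivity; eassumption.
Qed.

Global Instance pcong_app_Proper :
  Proper (pcong R ==> pcong R ==> pcong R) (@app X).
Proof.
intros u u' Hu v v' Hv; transitivity (u' ++ v).
- exact (pcong_ctx [] v u u' Hu).
- generalize (pcong_ctx u' [] v v' Hv); now rewrite !app_nil_r.
Qed.

Global Instance pcong_cons_Proper x : Proper (pcong R ==> pcong R) (cons x).
Proof. intros u v H; change (pcong R ([x] ++ u) ([x] ++ v)); now rewrite H. Qed.

Lemma pcong_rel u v : R u v -> pcong R u v.
Proof. intros H; generalize (pc_rel R u v [] [] H); simpl; now rewrite !app_nil_r. Qed.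

Lemma pcong_map (f : X -> X) :
  (forall u v, R u v -> R (map f u) (map f v)) ->
  forall u v, pcong R u v -> pcong R (map f u) (map f v).
Proof.
intros Hf; induction 1 as [u v p q H | | |].
- rewrite !map_app; apply pc_rel; auto.
- reflexivity.
- now symmetry.
- etransitivity; eassumption.
Qed.

End PresentationCongruence.

(** * Fractions and normal forms in Thompson's group *)

Definition tflip (l : tletter) : tletter :=
  match l with tgen n => tinv n | tinv n => tgen n end.

Definition tshift (l : tletter) : tletter :=
  match l with tgen n => tgen (S n) | tinv n => tinv (S n) end.

Definition winv (u : list tletter) : list tletter := rev (map tflip u).

Definition tpos (p : list nat) : list tletter := map tgen p.

Local Infix "~~" := (pcong thompson_rel) (at level 70).

Lemma tpos_app p q : tpos (p ++ q) = tpos p ++ tpos q.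
Proof. apply map_app. Qed.

Lemma tpos_S p : tpos (map S p) = map tshift (tpos p).
Proof. unfold tpos; now rewrite !map_map. Qed.

(** The relations only compare indices, so raising all of them is harmless. This shift will
    correspond to [f |-> 1 (x) f]. *)
Lemma tshift_pcong u v : u ~~ v -> map tshift u ~~ map tshift v.
Proof.
apply pcong_map; intros p q H; destruct H; simpl; constructor; lia.
Qed.

Lemma winv_app u v : winv (u ++ v) = winv v ++ winv u.
Proof. unfold winv; now rewrite map_app, rev_app_distr. Qed.

Lemma winv_involutive u : winv (winv u) = u.
Proof.
unfold winv; rewrite map_rev, rev_involutive, map_map.
induction u as [|[n|n] u IH]; simpl; congruence.
Qed.

Lemma pcong_gen_inv n : [tgen n; tinv n] ~~ [].
Proof. apply pcong_rel; constructor. Qed.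

Lemma pcong_inv_gen n : [tinv n; tgen n] ~~ [].
Proof. apply pcong_rel; constructor. Qed.

Lemma pcong_flip_r l : [l; tflip l] ~~ [].
Proof. destruct l; [apply pcong_gen_inv | apply pcong_inv_gen]. Qed.

Lemma winv_r u : u ++ winv u ~~ [].
Proof.
induction u as [|l u IH]; [reflexivity|].
change (winv (l :: u)) with (winv u ++ [tflip l]).
simpl; rewrite app_assoc, IH; apply pcong_flip_r.
Qed.

Lemma winv_l u : winv u ++ u ~~ [].
Proof. generalize (winv_r (winv u)); now rewrite winv_involutive. Qed.

Lemma pcong_gen_gen i j : i < j -> [tgen j; tgen i] ~~ [tgen i; tgen (S j)].
Proof.
intros H.
transitivity ([tgen i; tinv i] ++ [tgen j; tgen i]).
- now rewrite pcong_gen_inv.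
- change ([tgen i] ++ [tinv i; tgen j; tgen i] ~~ [tgen i; tgen (S j)]).
  now rewrite (pcong_rel _ _ _ (tr_conj i j H)).
Qed.

Lemma pcong_inv_gen_lt i j :
  i < j -> [tinv i; tgen j] ~~ [tgen (S j); tinv i].
Proof.
intros H.
transitivity ([tinv i; tgen j] ++ [tgen i; tinv i]).
- now rewrite pcong_gen_inv.
- change ([tinv i; tgen j; tgen i] ++ [tinv i] ~~ [tgen (S j); tinv i]).
  now rewrite (pcong_rel _ _ _ (tr_conj i j H)).
Qed.

Lemma pcong_inv_gen_gt i j :
  j < i -> [tinv i; tgen j] ~~ [tgen j; tinv (S i)].
Proof.
intros H.
transitivity ([tinv i; tgen j] ++ [tgen (S i); tinv (S i)]).
- now rewrite pcong_gen_inv.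
- change ([tinv i] ++ [tgen j; tgen (S i)] ++ [tinv (S i)]
          ~~ [tgen j; tinv (S i)]).
  rewrite <- (pcong_gen_gen _ _ H).
  change ([tinv i; tgen i] ++ [tgen j; tinv (S i)] ~~ [tgen j; tinv (S i)]).
  now rewrite pcong_inv_gen.
Qed.

(** The inverse moves right through [p]. Passing a smaller index raises [i], hence the
    generalisation over [i]; meeting its own index cancels it and ends the process. *)
Lemma inv_pos_fraction i p :
  exists p' q, tinv i :: tpos p ~~ tpos p' ++ winv (tpos q).
Proof.
revert i; induction p as [|j p IH]; intros i.
- exists [], [i]; reflexivity.
- change (tinv i :: tpos (j :: p)) with ([tinv i; tgen j] ++ tpos p).
  destruct (lt_eq_lt_dec i j) as [[H|<-]|H].
  + destruct (IH i) as (p' & q & E); exists (S j :: p'), q.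
    rewrite (pcong_inv_gen_lt _ _ H); simpl; now rewrite E.
  + exists p, []; now rewrite pcong_inv_gen, app_nil_r.
  + destruct (IH (S i)) as (p' & q & E); exists (j :: p'), q.
    rewrite (pcong_inv_gen_gt _ _ H); simpl; now rewrite E.
Qed.

Lemma word_fraction u : exists p q, u ~~ tpos p ++ winv (tpos q).
Proof.
induction u as [|[i|i] u (p & q & E)].
- exists [], []; reflexivity.
- exists (i :: p), q; simpl; now rewrite E.
- destruct (inv_pos_fraction i p) as (p' & q' & E').
  (* Since [winv] reverses words, the inverses released by [p] stand before [winv (tpos q)] exactly
     when [q'] comes after [q]. *)
  exists p', (q ++ q').
  rewrite E, tpos_app, winv_app, app_assoc, <- E'; reflexivity.
Qed.

(* [tnf [a0; a1; ...]] is the word [x_0^a0 x_1^a1 ...]. *)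
Fixpoint tnf (l : list nat) : list nat :=
  match l with
  | [] => []
  | a :: l => repeat 0 a ++ map S (tnf l)
  end.

Lemma pos_S_gen0 p :
  tpos (map S p) ++ [tgen 0] ~~ tgen 0 :: tpos (map S (map S p)).
Proof.
induction p as [|j p IH]; [reflexivity|]; simpl.
rewrite IH.
change ([tgen (S j); tgen 0] ++ tpos (map S (map S p))
  ~~ [tgen 0; tgen (S (S j))] ++ tpos (map S (map S p))).
now rewrite (pcong_gen_gen 0 (S j)) by lia.
Qed.

(** Induction on [j]: a letter [x_0] travels left to the block of [x_0]'s, and a letter of positive
    index is absorbed by the tail, with indices lowered by one. *)
Lemma tnf_snoc l j :
  exists l', tpos (tnf l) ++ [tgen j] ~~ tpos (tnf l').
Proof.
revert l; induction j as [|j IH]; intros l.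
- destruct l as [|a l]; [exists [1]; reflexivity|].
  (* When [x_0] passes the tail, its indices rise once more; the inserted [0] is the new exponent of
     [x_1]. *)
  exists (S a :: 0 :: l); simpl tnf.
  rewrite app_comm_cons, repeat_cons, !tpos_app, <- !app_assoc, pos_S_gen0; reflexivity.
- assert (H : forall a l, exists l',
      tpos (tnf (a :: l)) ++ [tgen (S j)] ~~ tpos (tnf l')).
  { intros a l0; destruct (IH l0) as [l' E]; exists (a :: l'); simpl tnf.
    rewrite !tpos_app, <- app_assoc, !tpos_S, <- (tshift_pcong _ _ E), map_app.
    reflexivity. }
  (* The empty list stands for the same word as [[0]]. *)
  destruct l as [|a l]; [apply (H 0 []) | apply H].
Qed.

Lemma pos_tnf p : exists l, tpos p ~~ tpos (tnf l).
Proof.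
induction p as [|j p [l E]] using rev_ind; [exists []; reflexivity|].
destruct (tnf_snoc l j) as [l' E'].
exists l'; rewrite tpos_app, E; exact E'.
Qed.

(** * Monoids generated by words *)

Record IsMonoid {M : Type} (e : M) (mul : M -> M -> M) : Prop := {
  mon_1l : forall x, mul e x = x;
  mon_1r : forall x, mul x e = x;
  mon_A : forall x y z, mul x (mul y z) = mul (mul x y) z }.

Section Evaluation.
Context {M : Type} {e : M} {mul : M -> M -> M} (HM : IsMonoid e mul).
Local Infix "*" := mul.

Definition weval {X : Type} (h : X -> M) (u : list X) : M :=
  fold_right (fun l m => h l * m) e u.

Lemma weval_app {X : Type} (h : X -> M) u v :
  weval h (u ++ v) = weval h u * weval h v.
Proof.
induction u as [|l u IH]; simpl; [now rewrite (mon_1l _ _ HM)|].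
now rewrite IH, (mon_A _ _ HM).
Qed.

Lemma weval_pcong {X : Type} (R : list X -> list X -> Prop) (h : X -> M) :
  (forall u v, R u v -> weval h u = weval h v) ->
  forall u v, pcong R u v -> weval h u = weval h v.
Proof.
intros HR; induction 1 as [u v p q H | | |]; try congruence.
now rewrite !weval_app, (HR _ _ H).
Qed.

Fixpoint mpow (x : M) (n : nat) : M :=
  match n with 0 => e | S n => x * mpow x n end.

Lemma mpow_add x m n : mpow x (m + n) = mpow x m * mpow x n.
Proof.
induction m as [|m IH]; simpl; [now rewrite (mon_1l _ _ HM)|].
now rewrite IH, (mon_A _ _ HM).
Qed.

Lemma mpow_comm x n : mpow x n * x = x * mpow x n.
Proof.
generalize (mpow_add x n 1); simpl; rewrite (mon_1r _ _ HM).
intros <-; now rewrite Nat.add_comm.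
Qed.

Lemma mpow_inv x y n : x * y = e -> mpow x n * mpow y n = e.
Proof.
intros H; induction n as [|n IH]; [apply (mon_1l _ _ HM)|].
simpl; rewrite <- mpow_comm, <- (mon_A _ _ HM), (mon_A _ _ HM x y), H.
now rewrite (mon_1l _ _ HM).
Qed.

Lemma weval_repeat {X : Type} (h : X -> M) l n :
  weval h (repeat l n) = mpow (h l) n.
Proof. induction n as [|n IH]; simpl; congruence. Qed.

(** * Faithful representations of the bicyclic monoid *)

Section Bicyclic.
Context (r s : M) (Hrs : r * s = e) (Hsr : s * r <> e).

Definition bletter_eval (l : bletter) : M := match l with br => r | bs => s end.

Lemma bicyclic_normal_form u :
  exists i j, pcong bicyclic_rel u (repeat bs i ++ repeat br j).
Proof.
induction u as [|[] u (i & j & E)].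
- exists 0, 0; reflexivity.
- destruct i as [|i].
  + exists 0, (S j); now rewrite E.
  + exists i, j; rewrite E.
    change (pcong bicyclic_rel ([br; bs] ++ (repeat bs i ++ repeat br j))
      (repeat bs i ++ repeat br j)).
    now rewrite (pcong_rel _ _ _ br_rs).
- exists (S i), j; now rewrite E.
Qed.

(** A right inverse of [s] would coincide with its left inverse [r], against [Hsr]. *)
Lemma bicyclic_no_right_inverse x : s * x <> e.
Proof.
intros H; apply Hsr.
assert (E : x = r) by
  now rewrite <- (mon_1l _ _ HM x), <- Hrs, <- (mon_A _ _ HM), H, (mon_1r _ _ HM).
congruence.
Qed.

Lemma bicyclic_no_left_inverse x : x * r <> e.
Proof.
intros H; apply Hsr.
assert (E : x = s) by
  now rewrite <- (mon_1r _ _ HM x), <- Hrs, (mon_A _ _ HM), H, (mon_1l _ _ HM).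
congruence.
Qed.

(** If [i < k], multiplying by [r^i] on the left and by [s^j] on the right exhibits a right inverse
    of [s]. *)
Lemma mpow_bicyclic_le i j k l :
  mpow s i * mpow r j = mpow s k * mpow r l -> k <= i.
Proof.
intros H; destruct (le_lt_dec k i) as [|Hlt]; [assumption | exfalso].
replace k with (i + S (k - S i)) in H by lia.
rewrite mpow_add, <- (mon_A _ _ HM) in H.
apply (f_equal (fun x => mpow r i * x)) in H.
rewrite !(mon_A _ _ HM), mpow_inv, !(mon_1l _ _ HM) in H by assumption.
apply (f_equal (fun x => x * mpow s j)) in H.
rewrite mpow_inv in H by assumption; simpl in H.
rewrite <- !(mon_A _ _ HM) in H.
symmetry in H; now apply bicyclic_no_right_inverse in H.
Qed.

(** If [j < l], multiplying by [s^j] on the right turns a positive power of [r] into [1], giving [r]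
    a left inverse. *)
Lemma mpow_r_le j l : mpow r j = mpow r l -> l <= j.
Proof.
intros H; destruct (le_lt_dec l j) as [|Hlt]; [assumption | exfalso].
replace l with (S (l - S j) + j) in H by lia.
rewrite mpow_add in H.
apply (f_equal (fun x => x * mpow s j)) in H.
rewrite <- (mon_A _ _ HM), mpow_inv, (mon_1r _ _ HM) in H by assumption.
simpl in H; rewrite <- mpow_comm in H.
symmetry in H; now apply bicyclic_no_left_inverse in H.
Qed.

Lemma bicyclic_faithful u v :
  weval bletter_eval u = weval bletter_eval v <-> pcong bicyclic_rel u v.
Proof.
assert (sound : forall u v, pcong bicyclic_rel u v ->
    weval bletter_eval u = weval bletter_eval v).
{ apply weval_pcong; intros ? ? []; simpl.
  now rewrite (mon_1r _ _ HM). }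
split; [|apply sound]; intros H.
destruct (bicyclic_normal_form u) as (i & j & Eu).
destruct (bicyclic_normal_form v) as (k & l & Ev).
rewrite (sound _ _ Eu), (sound _ _ Ev), !weval_app, !weval_repeat in H; simpl in H.
assert (i = k) as <- by
  (apply Nat.le_antisymm; eapply mpow_bicyclic_le; [symmetry|]; eassumption).
apply (f_equal (fun x => mpow r i * x)) in H.
rewrite !(mon_A _ _ HM), mpow_inv, !(mon_1l _ _ HM) in H by assumption.
assert (j = l) as <- by (apply Nat.le_antisymm; apply mpow_r_le; congruence).
now rewrite Eu, Ev.
Qed.

End Bicyclic.
End Evaluation.

(** * Semi-monoidal monoids *)

(** The one-object semi-monoidal category in purely algebraic form: [a] is the associator, and there
    is no unit object. *)
Record IsSemiMonoidal {M : Type} (e : M) (mul tn : M -> M -> M) (a a' : M) : Prop := {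
  sm_mon : IsMonoid e mul;
  sm_tens_1 : tn e e = e;
  sm_tens_mul : forall f f' g g', tn (mul f f') (mul g g') = mul (tn f g) (tn f' g');
  sm_inv_l : mul a' a = e;
  sm_inv_r : mul a a' = e;
  sm_nat : forall f g h, mul a (tn f (tn g h)) = mul (tn (tn f g) h) a;
  sm_pentagon : mul a a = mul (tn a e) (mul a (tn e a)) }.

(** * Thompson's group acting through the associator *)

Section Thompson.
Context {M : Type} {e : M} {mul tn : M -> M -> M} {a a' : M}.
Context (HS : IsSemiMonoidal e mul tn a a').
Local Infix "*" := mul.

Let HM : IsMonoid e mul := sm_mon _ _ _ _ _ HS.
Let m1l := mon_1l _ _ HM.
Let m1r := mon_1r _ _ HM.
Let mA := mon_A _ _ HM.

Definition rtens (f : M) : M := tn e f.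
Definition rtens_iter (n : nat) (f : M) : M := Nat.iter n rtens f.

Definition tletter_eval (l : tletter) : M :=
  match l with tgen n => rtens_iter n a | tinv n => rtens_iter n a' end.

Lemma rtens_mul f g : rtens (f * g) = rtens f * rtens g.
Proof. unfold rtens; now rewrite <- (sm_tens_mul _ _ _ _ _ HS), m1l. Qed.

Lemma rtens_1 : rtens e = e.
Proof. apply (sm_tens_1 _ _ _ _ _ HS). Qed.

Lemma rtens_iter_mul n f g : rtens_iter n (f * g) = rtens_iter n f * rtens_iter n g.
Proof. induction n as [|n IH]; simpl; [easy | now rewrite IH, rtens_mul]. Qed.

Lemma rtens_iter_1 n : rtens_iter n e = e.
Proof. induction n as [|n IH]; simpl; [easy | now rewrite IH, rtens_1]. Qed.

Lemma rtens_iter_add m n f : rtens_iter (m + n) f = rtens_iter m (rtens_iter n f).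
Proof. apply Nat.iter_add. Qed.

Lemma rtens_iter_succ_r n f : rtens_iter n (rtens f) = rtens (rtens_iter n f).
Proof. apply Nat.iter_swap. Qed.

(** Naturality of [a] at [(1, 1, f)], with [1 (x) 1 = 1]; for [f] an iterate of [a] it is the
    conjugation relation for [x_0]. *)
Lemma rtens_assoc f : rtens f * a = a * rtens (rtens f).
Proof. unfold rtens; now rewrite (sm_nat _ _ _ _ _ HS), (sm_tens_1 _ _ _ _ _ HS). Qed.

Lemma rtens_mpow_assoc f n :
  rtens f * mpow (e := e) (mul := mul) a n
  = mpow (e := e) (mul := mul) a n * rtens_iter n (rtens f).
Proof.
revert f; induction n as [|n IH]; intros f; simpl; [now rewrite m1l, m1r|].
now rewrite mA, rtens_assoc, <- mA, IH, <- mA, rtens_iter_succ_r.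
Qed.

Lemma a_cancel_l f g : a * f = a * g -> f = g.
Proof.
intros H; rewrite <- (m1l f), <- (m1l g), <- (sm_inv_l _ _ _ _ _ HS), <- !mA.
now rewrite H.
Qed.

Lemma mpow_a_cancel_l n f g :
  mpow (e := e) (mul := mul) a n * f = mpow (e := e) (mul := mul) a n * g -> f = g.
Proof.
induction n as [|n IH]; simpl; [now rewrite !m1l|].
rewrite <- !mA; intros H; now apply IH, a_cancel_l.
Qed.

(** Apply [1 (x) -] to the case [i = 0] exactly [i] times. *)
Lemma rtens_iter_a_conj i j :
  i < j -> rtens_iter j a * rtens_iter i a = rtens_iter i a * rtens_iter (S j) a.
Proof.
intros H; replace j with (i + S (j - S i)) by lia.
rewrite <- Nat.add_succ_r, !rtens_iter_add, <- !rtens_iter_mul; f_equal.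
apply rtens_assoc.
Qed.

Local Notation phi := (weval (e := e) (mul := mul) tletter_eval).

Lemma thompson_sound u v : pcong thompson_rel u v -> phi u = phi v.
Proof.
apply (weval_pcong HM); intros ? ? [n|n|i j H]; cbn [weval fold_right tletter_eval].
- rewrite m1r, <- rtens_iter_mul, (sm_inv_r _ _ _ _ _ HS); apply rtens_iter_1.
- rewrite m1r, <- rtens_iter_mul, (sm_inv_l _ _ _ _ _ HS); apply rtens_iter_1.
- rewrite !m1r, rtens_iter_a_conj, mA, <- rtens_iter_mul by assumption.
  now rewrite (sm_inv_l _ _ _ _ _ HS), rtens_iter_1, m1l.
Qed.

Lemma weval_tshift u : phi (map tshift u) = rtens (phi u).
Proof.
induction u as [|l u IH]; [symmetry; apply rtens_1|].
change (tletter_eval (tshift l) * phi (map tshift u)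
        = rtens (tletter_eval l * phi u)).
now rewrite IH, rtens_mul; destruct l.
Qed.

Lemma weval_winv_r u : phi u * phi (winv u) = e.
Proof. rewrite <- (weval_app HM); apply (thompson_sound _ []), winv_r. Qed.

Lemma weval_winv_l u : phi (winv u) * phi u = e.
Proof. rewrite <- (weval_app HM); apply (thompson_sound _ []), winv_l. Qed.

(* By the pentagon, [a (x) 1 = a^2 (1 (x) a)^-1 a^-1], and naturality moves
   [(1 (x) f) (x) 1] to [1 (x) (f (x) 1)]. *)
Lemma thompson_image_tens_e u : exists v, phi v = tn (phi u) e.
Proof.
assert (Ha : a = phi [tgen 0]) by (symmetry; apply m1r).
assert (Ha' : a' = phi [tinv 0]) by (symmetry; apply m1r).
assert (gen0 : exists v, phi v = tn a e).
{ exists [tgen 0; tgen 0; tinv 1; tinv 0]; cbn.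
  rewrite m1r, (mA a a), (sm_pentagon _ _ _ _ _ HS).
  rewrite <- !mA, (mA (tn e a)); change (tn e a) with (rtens a).
  rewrite <- rtens_mul, (sm_inv_r _ _ _ _ _ HS), rtens_1, m1l.
  now rewrite (sm_inv_r _ _ _ _ _ HS), m1r. }
assert (inv0 : exists v, phi v = tn a' e).
(* Uniqueness of inverses: [phi (winv v)] is a left inverse and [tn a' e] a right inverse of
   [tn a e]. *)
{ destruct gen0 as [v E]; exists (winv v).
  assert (Ht : tn a e * tn a' e = e).
  { rewrite <- (sm_tens_mul _ _ _ _ _ HS), (sm_inv_r _ _ _ _ _ HS), m1l.
    apply (sm_tens_1 _ _ _ _ _ HS). }
  transitivity (phi (winv v) * (tn a e * tn a' e)).
  - now rewrite Ht, m1r.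
  - now rewrite <- E, mA, weval_winv_l, m1l. }
assert (step : forall f, (exists v, phi v = tn f e) ->
    exists v, phi v = tn (rtens f) e).
{ intros f [v E]; exists ([tgen 0] ++ map tshift v ++ [tinv 0]).
  rewrite !(weval_app HM), weval_tshift, E, <- Ha, <- Ha'.
  unfold rtens; rewrite mA, (sm_nat _ _ _ _ _ HS), <- mA.
  now rewrite (sm_inv_r _ _ _ _ _ HS), m1r. }
induction u as [|l u [v E]].
- exists []; symmetry; apply (sm_tens_1 _ _ _ _ _ HS).
- assert (exists w, phi w = tn (tletter_eval l) e) as [w Ew].
  { destruct l as [n|n]; simpl; induction n as [|n IH]; simpl; auto. }
  exists (w ++ v); rewrite (weval_app HM), Ew, E; simpl.
  now rewrite <- (sm_tens_mul _ _ _ _ _ HS), m1l.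
Qed.

(** By interchange, [f (x) g = (f (x) 1) (1 (x) g)], and the second factor is an index shift. *)
Lemma thompson_image_tens u v : exists w, phi w = tn (phi u) (phi v).
Proof.
destruct (thompson_image_tens_e u) as [u' E].
exists (u' ++ map tshift v).
rewrite (weval_app HM), weval_tshift, E; unfold rtens.
now rewrite <- (sm_tens_mul _ _ _ _ _ HS), m1l, m1r.
Qed.

(** * Faithfulness of the action *)

Context (tens_inj_l : forall f g, tn e f = tn e g -> f = g).
Context (tens_inj_r : forall f g, tn f e = tn g e -> f = g).
Context (a_neq_1 : a <> e).

Lemma rtens_iter_inj n f g : rtens_iter n f = rtens_iter n g -> f = g.
Proof. induction n as [|n IH]; simpl; auto. Qed.

(** If [1 (x) a = a], the pentagon reads [a a = (a (x) 1) a a]; hence [a (x) 1 = 1 = 1 (x) 1] and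
    [a = 1]. *)
Lemma rtens_a_neq : rtens a <> a.
Proof.
intros E; apply a_neq_1, tens_inj_r.
assert (H := sm_pentagon _ _ _ _ _ HS).
change (tn e a) with (rtens a) in H; rewrite E in H.
apply (f_equal (fun x => x * (a' * a'))) in H.
rewrite <- !mA, (mA a a'), (sm_inv_r _ _ _ _ _ HS), m1l, (sm_inv_r _ _ _ _ _ HS), m1r in H.
now rewrite <- H, (sm_tens_1 _ _ _ _ _ HS).
Qed.

(* If [a^c = 1 (x) g], conjugating by [g] is [f |-> 1 (x) ... (x) 1 (x) f]
   ([c] factors), so [g] and hence [a^c] are fixed by that map; comparing the two
   resulting conjugates of [1 (x) ... (x) a] forces [1 (x) a = a]. *)
Lemma mpow_a_neq_rtens n g : mpow (e := e) (mul := mul) a (S n) <> rtens g.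
Proof.
intros E; set (c := S n) in *.
set (ac := mpow a c) in *.
assert (conj_g : forall f, f * g = g * rtens_iter c f).
{ intros f; apply tens_inj_l; fold (rtens (f * g)) (rtens (g * rtens_iter c f)).
  now rewrite !rtens_mul, <- E, <- rtens_iter_succ_r; apply rtens_mpow_assoc. }
(* Take [f = g] in [conj_g] and cancel [g] on the left, which is possible because [1 (x) g = a^c]
   cancels. *)
assert (fix_g : g = rtens_iter c g).
{ apply tens_inj_l, (mpow_a_cancel_l c); fold (rtens g) (rtens (rtens_iter c g)).
  fold ac; rewrite E, <- !rtens_mul; f_equal; apply conj_g. }
assert (fix_ac : rtens_iter c ac = ac).
{ now rewrite E, rtens_iter_succ_r, <- fix_g. }
(* As [ac] commutes with [a] and is fixed by [rtens_iter c], it commutes with [rtens_iter c a];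
   naturality evaluates the same conjugate as [rtens_iter c (rtens_iter c a)]. *)
assert (fix_a : a = rtens_iter c a).
{ apply (rtens_iter_inj c), (mpow_a_cancel_l c); fold ac.
  transitivity (rtens_iter c a * ac).
  - rewrite <- fix_ac at 1 2; rewrite <- !rtens_iter_mul; f_equal.
    apply (mpow_comm HM).
  - change (rtens_iter c a) with (rtens (rtens_iter n a)).
    apply rtens_mpow_assoc. }
(* Now [a] has the form [1 (x) h], so naturality gives [a a = a (1 (x) a)]. *)
apply rtens_a_neq, a_cancel_l; symmetry.
rewrite fix_a at 1.
change (rtens_iter c a) with (rtens (rtens_iter n a)).
rewrite rtens_assoc.
change (rtens (rtens_iter n a)) with (rtens_iter c a).
now rewrite <- fix_a.
Qed.

Lemma weval_tnf_cons k l :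
  phi (tpos (tnf (k :: l)))
  = mpow (e := e) (mul := mul) a k * rtens (phi (tpos (tnf l))).
Proof.
simpl; rewrite tpos_app, (weval_app HM), tpos_S, weval_tshift.
f_equal; unfold tpos; rewrite map_repeat; apply (weval_repeat tletter_eval).
Qed.

(** If [k < m], cancelling [a^k] and inverting [rtens (phi q)] writes a positive power of [a] as
    [1 (x) g]. *)
Lemma tnf_exponent_le k p m q :
  mpow (e := e) (mul := mul) a k * rtens (phi p)
  = mpow (e := e) (mul := mul) a m * rtens (phi q) -> m <= k.
Proof.
intros H; destruct (le_lt_dec m k) as [|Hlt]; [assumption | exfalso].
replace m with (k + S (m - S k)) in H by lia.
rewrite (mpow_add HM), <- mA in H; apply mpow_a_cancel_l in H.
apply (f_equal (fun x => x * rtens (phi (winv q)))) in H.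
rewrite <- mA, <- !rtens_mul, weval_winv_r, rtens_1, m1r in H.
symmetry in H; now apply mpow_a_neq_rtens in H.
Qed.

(** The exponents of [x_0] agree, so [a^k] and then [1 (x) -] cancel. The induction hypothesis is a
    premise so that lists of different lengths can be compared after padding with [0]. *)
Lemma tnf_cons_faithful k l m l' :
  (phi (tpos (tnf l)) = phi (tpos (tnf l')) ->
   pcong thompson_rel (tpos (tnf l)) (tpos (tnf l'))) ->
  phi (tpos (tnf (k :: l))) = phi (tpos (tnf (m :: l'))) ->
  pcong thompson_rel (tpos (tnf (k :: l))) (tpos (tnf (m :: l'))).
Proof.
intros IH H; rewrite !weval_tnf_cons in H.
assert (k = m) as <- by
  (apply Nat.le_antisymm; eapply tnf_exponent_le; [symmetry|]; eassumption).
apply mpow_a_cancel_l, tens_inj_l, IH, tshift_pcong in H.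
simpl; now rewrite !tpos_app, !tpos_S, H.
Qed.

Lemma tnf_faithful l l' :
  phi (tpos (tnf l)) = phi (tpos (tnf l')) ->
  pcong thompson_rel (tpos (tnf l)) (tpos (tnf l')).
Proof.
revert l'; induction l as [|k l IH]; intros l'.
- induction l' as [|m l' IH']; [reflexivity|].
  (* [tnf []] and [tnf [0]] are convertible, so the shorter list is padded. *)
  apply (tnf_cons_faithful 0 []), IH'.
- destruct l' as [|m l'].
  + apply (tnf_cons_faithful k l 0 []), (IH []).
  + apply tnf_cons_faithful, IH.
Qed.

Lemma thompson_trivial_kernel u : phi u = e -> pcong thompson_rel u [].
Proof.
intros H; destruct (word_fraction u) as (p & q & E).
rewrite (thompson_sound _ _ E), (weval_app HM) in H.
destruct (pos_tnf p) as [l El], (pos_tnf q) as [l' El'].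
apply (f_equal (fun x => x * phi (tpos q))) in H.
rewrite <- mA, weval_winv_l, m1l, m1r in H.
rewrite (thompson_sound _ _ El), (thompson_sound _ _ El') in H.
apply tnf_faithful in H.
rewrite E, El, H, <- El'; apply winv_r.
Qed.

Lemma thompson_faithful u v : phi u = phi v <-> pcong thompson_rel u v.
Proof.
split; [intros H | apply thompson_sound].
assert (K : pcong thompson_rel (winv v ++ u) []).
{ apply thompson_trivial_kernel; rewrite (weval_app HM), H; apply weval_winv_l. }
transitivity (v ++ (winv v ++ u)).
- now rewrite app_assoc, winv_r.
- now rewrite K, app_nil_r.
Qed.

End Thompson.

(** * Compact closed categories with trivial scalars *)

Section CompactClosed.
Context {K : CCData} (HK : IsCompactClosed K).
Local Infix "∘" := cmp (at level 40, left associativity).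
Local Infix "⊗" := tensm (at level 35, no associativity).
Local Notation "1_( A )" := (idm A) (format "1_( A )").

Let idl {A B : Obj K} (f : Hom A B) := cmp_idl K HK A B f.
Let idr {A B : Obj K} (f : Hom A B) := cmp_idr K HK A B f.
Let cA {A B C D : Obj K} (f : Hom A B) (g : Hom B C) (h : Hom C D) :=
  cmp_assoc K HK A B C D f g h.

(** Composites are kept nested to the right; this form rewrites two adjacent arrows in the middle of
    such a chain. *)
Lemma cmp_square_ext {A B B' C D : Obj K} {g : Hom B C} {f : Hom A B}
  {g' : Hom B' C} {f' : Hom A B'} (h : Hom D A) :
  g ∘ f = g' ∘ f' -> g ∘ (f ∘ h) = g' ∘ (f' ∘ h).
Proof. intros E; now rewrite !cA, E. Qed.

Lemma cmp_retract_ext {A B D : Obj K} {g : Hom B A} {f : Hom A B} (h : Hom D A) :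
  g ∘ f = 1_(A) -> g ∘ (f ∘ h) = h.
Proof. intros E; now rewrite cA, E, idl. Qed.

Lemma tensm_fuse {A1 A2 A3 B1 B2 B3 : Obj K} (f : Hom A1 A2) (g : Hom A2 A3)
  (f' : Hom B1 B2) (g' : Hom B2 B3) :
  (g ⊗ g') ∘ (f ⊗ f') = (g ∘ f) ⊗ (g' ∘ f').
Proof. symmetry; apply (tensm_cmp K HK). Qed.

Lemma tensm_fuse_ext {A1 A2 A3 B1 B2 B3 D : Obj K} (f : Hom A1 A2) (g : Hom A2 A3)
  (f' : Hom B1 B2) (g' : Hom B2 B3) (h : Hom D (tens A1 B1)) :
  (g ⊗ g') ∘ ((f ⊗ f') ∘ h) = ((g ∘ f) ⊗ (g' ∘ f')) ∘ h.
Proof. now rewrite cA, tensm_fuse. Qed.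

Lemma tens_unit_cancel_r {X Y : Obj K} (f g : Hom X Y) :
  f ⊗ 1_(tunit K) = g ⊗ 1_(tunit K) -> f = g.
Proof.
intros E; rewrite <- (idr f), <- (idr g), <- (runit_iso2 K HK X), !cA.
now rewrite <- !(runit_nat K HK), E.
Qed.

Lemma tens_unit_cancel_l {X Y : Obj K} (f g : Hom X Y) :
  1_(tunit K) ⊗ f = 1_(tunit K) ⊗ g -> f = g.
Proof.
intros E; rewrite <- (idr f), <- (idr g), <- (lunit_iso2 K HK X), !cA.
now rewrite <- !(lunit_nat K HK), E.
Qed.

Lemma tens_tens_id_r {X Y : Obj K} (f : Hom X Y) (A B : Obj K) :
  f ⊗ 1_(tens A B) = assoc_inv Y A B ∘ (((f ⊗ 1_(A)) ⊗ 1_(B)) ∘ assoc X A B).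
Proof.
rewrite <- (assoc_nat K HK), (tensm_id K HK).
now rewrite (cmp_retract_ext _ (assoc_iso1 K HK _ _ _)).
Qed.

Lemma tens_tens_id_l {X Y : Obj K} (f : Hom X Y) (A B : Obj K) :
  1_(tens A B) ⊗ f = assoc A B Y ∘ ((1_(A) ⊗ (1_(B) ⊗ f)) ∘ assoc_inv A B X).
Proof.
rewrite (cmp_square_ext _ (assoc_nat K HK _ _ _ _ _ _ _ _ _)), (tensm_id K HK).
now rewrite (assoc_iso2 K HK), idr.
Qed.

(** * Cancelling tensor factors when the unit is a retract of [A (x) B] *)

Section Retract.
Context {A B : Obj K} (P : Hom (tunit K) (tens A B)) (Q : Hom (tens A B) (tunit K))
  (HQP : Q ∘ P = 1_(tunit K)).

(** The retraction recovers [f (x) 1_I] from [f (x) 1_(A (x) B)], which is [f (x) 1_A] tensored with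
    [1_B] up to associators. *)
Lemma tens_cancel_r {X Y : Obj K} (f g : Hom X Y) :
  f ⊗ 1_(A) = g ⊗ 1_(A) -> f = g.
Proof.
intros E; apply tens_unit_cancel_r.
assert (F : forall h : Hom X Y, h ⊗ 1_(tunit K)
    = (1_(Y) ⊗ Q) ∘ ((h ⊗ 1_(tens A B)) ∘ (1_(X) ⊗ P))).
{ intros h; now rewrite !tensm_fuse, idl, idr, idl, HQP. }
now rewrite (F f), (F g), !tens_tens_id_r, E.
Qed.

Lemma tens_cancel_l {X Y : Obj K} (f g : Hom X Y) :
  1_(B) ⊗ f = 1_(B) ⊗ g -> f = g.
Proof.
intros E; apply tens_unit_cancel_l.
assert (F : forall h : Hom X Y, 1_(tunit K) ⊗ h
    = (Q ⊗ 1_(Y)) ∘ ((1_(tens A B) ⊗ h) ∘ (P ⊗ 1_(X)))).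
{ intros h; now rewrite !tensm_fuse, idl, idr, idl, HQP. }
now rewrite (F f), (F g), !tens_tens_id_l, E.
Qed.

End Retract.

(** The associators cancel and leave the scalar [eps_dual A ∘ eta A], which is the identity once
    scalars are trivial. *)
Lemma Nabla0_Delta0 (A : Obj K) :
  Nabla0 A ∘ Delta0 A
  = ((runit (dual A) ∘ ((1_(dual A) ⊗ (eps_dual A ∘ eta A)) ∘ runit_inv (dual A)))
      ⊗ 1_(A)).
Proof.
unfold Nabla0, Delta0; rewrite <- !cA.
rewrite (cmp_retract_ext _ (assoc_iso2 K HK _ _ _)).
rewrite !tensm_fuse_ext, tensm_fuse, !idl; f_equal.
rewrite <- !cA, (cmp_retract_ext _ (assoc_iso1 K HK _ _ _)).
now rewrite tensm_fuse_ext, idl.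
Qed.

Lemma Delta0_Nabla0 (A : Obj K) :
  Delta0 A ∘ Nabla0 A
  = assoc_inv (tens (dual A) A) (dual A) A
    ∘ (((assoc (dual A) A (dual A)
         ∘ ((1_(dual A) ⊗ (eta A ∘ eps_dual A)) ∘ assoc_inv (dual A) A (dual A)))
        ⊗ 1_(A)) ∘ assoc (tens (dual A) A) (dual A) A).
Proof.
unfold Nabla0, Delta0; rewrite <- !cA.
rewrite !tensm_fuse_ext, !idl; do 3 f_equal.
rewrite <- !cA, (cmp_retract_ext _ (runit_iso1 K HK _)).
now rewrite tensm_fuse_ext, idl.
Qed.

(* [castH p q] is conjugation by the isomorphisms that [p] and [q] induce. *)
Definition eqhom {A B : Obj K} (p : A = B) : Hom A B := castH eq_refl p (idm A).

Lemma castH_eqhom {A B A' B' : Obj K} (p : A = A') (q : B = B') (f : Hom A B) :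
  castH p q f = eqhom q ∘ (f ∘ eqhom (eq_sym p)).
Proof. destruct p, q; unfold eqhom; simpl; now rewrite idl, idr. Qed.

Lemma eqhom_sym_r {A B : Obj K} (p : A = B) : eqhom p ∘ eqhom (eq_sym p) = 1_(B).
Proof. destruct p; apply idl. Qed.

Lemma eqhom_sym_l {A B : Obj K} (p : A = B) : eqhom (eq_sym p) ∘ eqhom p = 1_(A).
Proof. destruct p; apply idl. Qed.

Lemma eqhom_trans {A B C : Obj K} (p : A = B) (q : B = C) :
  eqhom (eq_trans p q) = eqhom q ∘ eqhom p.
Proof. destruct q; symmetry; apply idl. Qed.

Lemma eqhom_trans_sym {A B C : Obj K} (p : A = B) (q : B = C) :
  eqhom (eq_sym (eq_trans p q)) = eqhom (eq_sym p) ∘ eqhom (eq_sym q).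
Proof. destruct q; symmetry; apply idr. Qed.

Lemma eqhom_tens_l {A B : Obj K} (X : Obj K) (p : A = B) :
  eqhom (f_equal (tens X) p) = 1_(X) ⊗ eqhom p.
Proof. destruct p; symmetry; apply (tensm_id K HK). Qed.

Lemma eqhom_tens_l_sym {A B : Obj K} (X : Obj K) (p : A = B) :
  eqhom (eq_sym (f_equal (tens X) p)) = 1_(X) ⊗ eqhom (eq_sym p).
Proof. destruct p; symmetry; apply (tensm_id K HK). Qed.

Lemma eqhom_tens_r {A B : Obj K} (X : Obj K) (p : A = B) :
  eqhom (f_equal (fun Y => tens Y X) p) = eqhom p ⊗ 1_(X).
Proof. destruct p; symmetry; apply (tensm_id K HK). Qed.

Lemma eqhom_tens_r_sym {A B : Obj K} (X : Obj K) (p : A = B) :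
  eqhom (eq_sym (f_equal (fun Y => tens Y X) p)) = eqhom (eq_sym p) ⊗ 1_(X).
Proof. destruct p; symmetry; apply (tensm_id K HK). Qed.

(** * The endomorphisms of a strictly reflexive object *)

Section StrictlyReflexive.
Context (N : Obj K) (HNN : tens N N = N) (HdN : tens (dual N) N = N).

Let c : Hom (tens N N) N := eqhom HNN.
Let c' : Hom N (tens N N) := eqhom (eq_sym HNN).
Let cc' : c ∘ c' = 1_(N) := eqhom_sym_r HNN.
Let c'c : c' ∘ c = 1_(tens N N) := eqhom_sym_l HNN.
Local Infix "⊛" := (stens N HNN) (at level 35, no associativity).
Local Notation α := (alphaN N HNN).
Local Notation α' := (alphaN_inv N HNN).

Lemma stens_eqhom f g : f ⊛ g = c ∘ ((f ⊗ g) ∘ c').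
Proof. apply castH_eqhom. Qed.

Lemma alphaN_eqhom : α = c ∘ ((c ⊗ 1_(N)) ∘ (assoc N N N ∘ ((1_(N) ⊗ c') ∘ c'))).
Proof.
unfold alphaN; rewrite castH_eqhom; unfold eqNN_N, eqN_NN.
now rewrite eqhom_trans, eqhom_trans_sym, eqhom_tens_r, eqhom_tens_l_sym, <- cA.
Qed.

Lemma alphaN_inv_eqhom :
  α' = c ∘ ((1_(N) ⊗ c) ∘ (assoc_inv N N N ∘ ((c' ⊗ 1_(N)) ∘ c'))).
Proof.
unfold alphaN_inv; rewrite castH_eqhom; unfold eqNN_N, eqN_NN.
now rewrite eqhom_trans, eqhom_trans_sym, eqhom_tens_l, eqhom_tens_r_sym, <- cA.
Qed.

Lemma alphaN_nat f g h : α ∘ (f ⊛ (g ⊛ h)) = ((f ⊛ g) ⊛ h) ∘ α.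
Proof.
rewrite alphaN_eqhom, !stens_eqhom, <- !cA.
rewrite !(cmp_retract_ext _ c'c), !tensm_fuse_ext, !idr, idl.
rewrite <- !cA, (cmp_retract_ext _ c'c), c'c, idr.
replace (f ⊗ ((g ⊗ h) ∘ c')) with ((f ⊗ (g ⊗ h)) ∘ (1_(N) ⊗ c'))
  by now rewrite tensm_fuse, idr.
replace ((c ∘ (f ⊗ g)) ⊗ h) with ((c ⊗ 1_(N)) ∘ ((f ⊗ g) ⊗ h))
  by now rewrite tensm_fuse, idl.
rewrite <- !cA.
now rewrite (cmp_square_ext _ (assoc_nat K HK _ _ _ _ _ _ f g h)).
Qed.

Lemma alphaN_pentagon : α ∘ α = (α ⊛ 1_(N)) ∘ (α ∘ (1_(N) ⊛ α)).
Proof.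
set (a := assoc N N N).
(* The middle term is one side of the categorical pentagon, with the fourfold products identified
   with [N] through [c] and [c']. *)
transitivity (c ∘ (((c ∘ (c ⊗ 1_(N))) ⊗ 1_(N))
  ∘ (assoc (tens N N) N N ∘ (assoc N N (tens N N)
  ∘ ((1_(N) ⊗ ((1_(N) ⊗ c') ∘ c')) ∘ c'))))).
- rewrite alphaN_eqhom, <- !cA, (cmp_retract_ext _ c'c).
  rewrite (tensm_fuse_ext c 1_(N)), idl, idr.
  (* Splitting [c ⊗ c'] lets naturality carry [c] left and [c'] right across the two associators. *)
  replace (c ⊗ c') with ((c ⊗ (1_(N) ⊗ 1_(N))) ∘ ((1_(N) ⊗ 1_(N)) ⊗ c'))
    by now rewrite tensm_fuse, !(tensm_id K HK), idl, idr.
  rewrite <- !cA.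
  rewrite (cmp_square_ext _ (eq_sym (assoc_nat K HK _ _ _ _ _ _ 1_(N) 1_(N) c'))).
  rewrite (cmp_square_ext _ (assoc_nat K HK _ _ _ _ _ _ c 1_(N) 1_(N))).
  now rewrite !tensm_fuse_ext, !idl.
- rewrite (cmp_square_ext _ (pentagon K HK N N N N)); fold a.
  rewrite !stens_eqhom, alphaN_eqhom; fold a; rewrite <- !cA, !(cmp_retract_ext _ c'c).
  rewrite !tensm_fuse_ext, !idl.
  rewrite <- !cA, (cmp_retract_ext _ c'c).
  f_equal.
  replace ((c ∘ ((c ⊗ 1_(N)) ∘ (a ∘ ((1_(N) ⊗ c') ∘ (c' ∘ c))))) ⊗ 1_(N))
    with (((c ∘ (c ⊗ 1_(N))) ⊗ 1_(N)) ∘ ((a ⊗ 1_(N)) ∘ ((1_(N) ⊗ c') ⊗ 1_(N))))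
    by now rewrite !tensm_fuse, !idl, c'c, idr, <- !cA.
  replace (1_(N) ⊗ ((c ⊗ 1_(N)) ∘ (a ∘ ((1_(N) ⊗ c') ∘ c'))))
    with ((1_(N) ⊗ (c ⊗ 1_(N))) ∘ ((1_(N) ⊗ a) ∘ (1_(N) ⊗ ((1_(N) ⊗ c') ∘ c'))))
    by now rewrite !tensm_fuse, !idl.
  rewrite <- !cA.
  rewrite (cmp_square_ext _ (eq_sym (assoc_nat K HK _ _ _ _ _ _ 1_(N) c' 1_(N)))).
  now rewrite !tensm_fuse_ext, !tensm_fuse, c'c, !idl, !(tensm_id K HK), idl, <- !cA.
Qed.

Lemma alphaN_inv_l : α' ∘ α = 1_(N).
Proof.
rewrite alphaN_eqhom, alphaN_inv_eqhom, <- !cA, (cmp_retract_ext _ c'c).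
rewrite (tensm_fuse_ext c c'), c'c, idl, (tensm_id K HK), idl.
rewrite (cmp_retract_ext _ (assoc_iso1 K HK _ _ _)).
now rewrite tensm_fuse_ext, cc', idl, (tensm_id K HK), idl.
Qed.

Lemma alphaN_inv_r : α ∘ α' = 1_(N).
Proof.
rewrite alphaN_eqhom, alphaN_inv_eqhom, <- !cA, (cmp_retract_ext _ c'c).
rewrite (tensm_fuse_ext 1_(N) 1_(N) c c'), c'c, idl, (tensm_id K HK), idl.
rewrite (cmp_retract_ext _ (assoc_iso2 K HK _ _ _)).
now rewrite tensm_fuse_ext, cc', idl, (tensm_id K HK), idl.
Qed.

Lemma endo_monoid : IsMonoid 1_(N) (@cmp K N N N).
Proof. split; intros; [apply idl | apply idr | apply cA]. Qed.

Lemma endo_semi_monoidal :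
  IsSemiMonoidal 1_(N) (@cmp K N N N) (stens N HNN) α α'.
Proof.
split.
- apply endo_monoid.
- now rewrite stens_eqhom, (tensm_id K HK), idl.
- intros f f' g g'; rewrite !stens_eqhom, <- !cA, (cmp_retract_ext _ c'c).
  now rewrite tensm_fuse_ext.
- apply alphaN_inv_l.
- apply alphaN_inv_r.
- apply alphaN_nat.
- apply alphaN_pentagon.
Qed.

Lemma conj_eqhom_inj (f g : Hom (tens N N) (tens N N)) :
  c ∘ (f ∘ c') = c ∘ (g ∘ c') -> f = g.
Proof.
intros E; apply (f_equal (fun h => c' ∘ (h ∘ c))) in E.
now rewrite <- !cA, !(cmp_retract_ext _ c'c), !c'c, !idr in E.
Qed.

Context (Hscal : trivial_scalars K).

(** The retraction consists of the symmetrised unit and the counit of the duality; their composite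
    is a scalar, hence [1]. *)
Lemma stens_id_inj_l f g : 1_(N) ⊛ f = 1_(N) ⊛ g -> f = g.
Proof.
rewrite !stens_eqhom; intros E; apply conj_eqhom_inj in E; revert E.
exact (tens_cancel_l (sym N (dual N) ∘ eta N) (eps N) (Hscal _) f g).
Qed.

Lemma stens_id_inj_r f g : f ⊛ 1_(N) = g ⊛ 1_(N) -> f = g.
Proof.
rewrite !stens_eqhom; intros E; apply conj_eqhom_inj in E; revert E.
exact (tens_cancel_r (eta N) (eps_dual N) (Hscal _) f g).
Qed.

Context (Hnu : not_unit_object N HNN).

Lemma alphaN_neq_id : α <> 1_(N).
Proof.
intros E; assert (tt : 1_(N) ⊛ 1_(N) = 1_(N))
  by now rewrite stens_eqhom, (tensm_id K HK), idl.
assert (L : forall f, 1_(N) ⊛ f = f).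
(* With [α = 1], naturality reads [1 ⊛ (1 ⊛ f) = (1 ⊛ 1) ⊛ f = 1 ⊛ f]. *)
{ intros f; apply stens_id_inj_l; generalize (alphaN_nat 1_(N) 1_(N) f).
  now rewrite E, idl, idr, tt. }
assert (R : forall f, f ⊛ 1_(N) = f).
{ intros f; apply stens_id_inj_r; generalize (alphaN_nat f 1_(N) 1_(N)).
  now rewrite E, idl, idr, tt. }
apply Hnu; split; exists (fun f => f); auto.
Qed.

Lemma NablaN_DeltaN : NablaN N HNN HdN ∘ DeltaN N HNN HdN = 1_(N).
Proof.
unfold NablaN, DeltaN; rewrite !castH_eqhom, <- !cA.
rewrite (cmp_retract_ext _ (eqhom_sym_l _)).
rewrite (cA _ (Delta0 N) (Nabla0 N)), Nabla0_Delta0, (Hscal (_ ∘ _)).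
rewrite !(tensm_id K HK), idl, (runit_iso2 K HK), (tensm_id K HK), idl.
apply eqhom_sym_r.
Qed.

(* If the Frobenius algebra were invertible, cancelling [N*] and [N] would give
   [eta eps = 1], so [N = N* (x) N] would be isomorphic to [I] and have only one
   endomorphism. *)
Lemma DeltaN_NablaN : DeltaN N HNN HdN ∘ NablaN N HNN HdN <> 1_(N).
Proof.
intros E.
assert (E0 : Delta0 N ∘ Nabla0 N = idm _).
{ unfold NablaN, DeltaN in E; rewrite !castH_eqhom, <- !cA in E.
  rewrite (cmp_retract_ext _ (eqhom_sym_l _)) in E.
  apply (f_equal (fun h => eqhom (eq_sym (eqDD N HNN HdN))
    ∘ (h ∘ eqhom (eqDD N HNN HdN)))) in E.
  now rewrite <- !cA, (cmp_retract_ext _ (eqhom_sym_l _)), idl,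
    !eqhom_sym_l, idr in E. }
assert (E1 : eta N ∘ eps_dual N = idm _).
{ apply (tens_cancel_l (eta N) (eps_dual N) (Hscal _)).
  apply (tens_cancel_r (eta N) (eps_dual N) (Hscal _)).
  rewrite Delta0_Nabla0 in E0.
  apply (f_equal (fun h => assoc (tens (dual N) N) (dual N) N
    ∘ (h ∘ assoc_inv (tens (dual N) N) (dual N) N))) in E0.
  rewrite <- !cA, (cmp_retract_ext _ (assoc_iso2 K HK _ _ _)) in E0.
  rewrite idl, !(assoc_iso2 K HK), idr, <- (tensm_id K HK) in E0.
  apply (tens_cancel_r (eta N) (eps_dual N) (Hscal _)) in E0.
  apply (f_equal (fun h => assoc_inv (dual N) N (dual N)
    ∘ (h ∘ assoc (dual N) N (dual N)))) in E0.
  rewrite <- !cA, (cmp_retract_ext _ (assoc_iso1 K HK _ _ _)) in E0.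
  rewrite idl, !(assoc_iso1 K HK), idr in E0.
  now rewrite E0, !(tensm_id K HK). }
set (i := eqhom HdN ∘ (sym N (dual N) ∘ eta N)).
set (j := eps_dual N ∘ (sym (dual N) N ∘ eqhom (eq_sym HdN))).
assert (ij : i ∘ j = 1_(N)).
{ unfold i, j; rewrite <- !cA, (cmp_square_ext _ (eq_trans E1 (eq_sym (idl _)))).
  rewrite !idl, (cmp_retract_ext _ (sym_inv K HK _ _)); apply eqhom_sym_r. }
assert (single : forall f g : Hom N N, f = g).
{ enough (H : forall f : Hom N N, f = 1_(N)) by (intros f g; now rewrite (H f), (H g)).
  (* Here [f = i (j f i) j], and the scalar [j f i] is [1]. *)
  intros f; transitivity ((i ∘ j) ∘ (f ∘ (i ∘ j))).
  - now rewrite ij, idl, idr.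
  - now rewrite <- cA, (cA j i f), (cA j (f ∘ i) j), (Hscal (j ∘ _)), idl. }
apply Hnu; split; exists (fun f => f); split; intros; apply single.
Qed.

Lemma tclosure_alpha_eval f :
  tclosure N HNN (genAlpha N HNN) f
  <-> exists u, weval (e := 1_(N)) (mul := @cmp K N N N)
        (tletter_eval (e := 1_(N)) (tn := stens N HNN) (a := α) (a' := α')) u = f.
Proof.
set (T := tclosure N HNN (genAlpha N HNN)).
assert (Hα : T α) by (apply tc_base; now left).
assert (Hα' : T α') by (apply tc_base; now right).
(* [tclosure] has no constructor for the identity, which is obtained as [α ∘ α']. *)
assert (H1 : T 1_(N)) by (rewrite <- alphaN_inv_r; now apply tc_cmp).
split.
- induction 1 as [f [->| ->] | f g _ [u <-] _ [v <-] | f g _ [u <-] _ [v <-]].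
  + exists [tgen 0]; apply idr.
  + exists [tinv 0]; apply idr.
  + exists (u ++ v); apply (weval_app endo_monoid).
  + apply (thompson_image_tens endo_semi_monoidal).
- intros [u <-]; induction u as [|[n|n] u IH]; simpl; [exact H1 | |];
    apply tc_cmp; auto; induction n as [|n IHn]; simpl; auto; now apply tc_tens.
Qed.

Lemma mclosure_frob_eval f :
  mclosure N (genFrob N HNN HdN) f
  <-> exists u, weval (e := 1_(N)) (mul := @cmp K N N N)
        (bletter_eval (NablaN N HNN HdN) (DeltaN N HNN HdN)) u = f.
Proof.
split.
- induction 1 as [| f [->| ->] | f g _ [u <-] _ [v <-]].
  + exists []; reflexivity.
  + exists [bs]; apply idr.
  + exists [br]; apply idr.
  + exists (u ++ v); apply (weval_app endo_monoid).
- intros [u <-]; induction u as [|[] u IH]; simpl;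
    [apply mc_id | |]; apply mc_cmp; auto; apply mc_base; [now right | now left].
Qed.

End StrictlyReflexive.
End CompactClosed.

Theorem mainTheorem12 (K : CCData) (HK : IsCompactClosed K) (N : Obj K)
  (HdN : tens (dual N) N = N) (HNN : tens N N = N)
  (Hscal : trivial_scalars K) (Hnu : not_unit_object N HNN) :
  ((forall f, tclosure N HNN (genAlpha N HNN) f ->
              tclosure N HNN (genAll N HNN HdN) f) /\
   exists phi : list tletter -> Hom N N,
     presents_iso thompson_rel phi (tclosure N HNN (genAlpha N HNN))) /\
  (exists psi : list bletter -> Hom N N,
     presents_iso bicyclic_rel psi (mclosure N (genFrob N HNN HdN))).
Proof.
split; [split|].
- induction 1 as [f Hf | f g _ Hf _ Hg | f g _ Hf _ Hg].
  + apply tc_base; destruct Hf; [left | right; left]; assumption.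
  + now apply tc_cmp.
  + now apply tc_tens.
- exists (weval (e := idm N) (mul := @cmp K N N N)
    (tletter_eval (e := idm N) (tn := stens N HNN)
      (a := alphaN N HNN) (a' := alphaN_inv N HNN))).
  repeat split.
  + apply (weval_app (endo_monoid HK N)).
  + apply (thompson_faithful (endo_semi_monoidal HK N HNN)
      (stens_id_inj_l HK N HNN Hscal) (stens_id_inj_r HK N HNN Hscal)
      (alphaN_neq_id HK N HNN Hscal Hnu)).
  + apply (thompson_sound (endo_semi_monoidal HK N HNN)).
  + apply (tclosure_alpha_eval HK).
  + apply (tclosure_alpha_eval HK).
(* The relation [r s = 1] becomes [nabla . Delta = 1], so [r] goes to the merge and [s] to the split
   arrow. *)
- exists (weval (e := idm N) (mul := @cmp K N N N)
    (bletter_eval (NablaN N HNN HdN) (DeltaN N HNN HdN))).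
  assert (faithful := bicyclic_faithful (endo_monoid HK N) _ _
    (NablaN_DeltaN HK N HNN HdN Hscal) (DeltaN_NablaN HK N HNN HdN Hscal Hnu)).
  repeat split.
  + apply (weval_app (endo_monoid HK N)).
  + apply faithful.
  + apply faithful.
  + apply (mclosure_frob_eval HK).
  + apply (mclosure_frob_eval HK).
Qed.
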